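(* Let $p,q,r\ge 1$ with $p+q+r=n$, and let $A\in M_p(\mathbb{C})$, $C\in M_q(\mathbb{C})$, $E\in M_r(\mathbb{C})$ be Hermitian, $B\in M_{p\times q}(\mathbb{C})$, $D\in M_{q\times r}(\mathbb{C})$. For $X\in M_{p\times r}(\mathbb{C})$ let $$H(X)=\begin{pmatrix} A & B & X\\ B^\star & C & D\\ X^\star & D^\star & E\end{pmatrix}\in M_n(\mathbb{C}).$$ Assume that the two matrices $$\begin{pmatrix} A & B\\ B^\star & C\end{pmatrix}\quad\text{and}\quad \begin{pmatrix} C & D\\ D^\star & E\end{pmatrix}$$ are positive semidefinite and of maximal rank (with respect to the displayed partitions). Then $X=BC^+D$ is the unique $X\in M_{p\times r}(\mathbb{C})$ such that $H(X)$ is (positive semidefinite and) of maximal rank with respect to the displayed $3\times 3$ block partition and such that the Moore-Penrose inverse $H(X)^+$, partitioned in the same way as $H(X)$, has zero block in the position of $X$ (the upper right $p\times r$ block).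
   Context: $M^\star$ denotes the conjugate transpose, $M^+$ the Moore-Penrose inverse, and $N(M)$ the nullspace of a matrix $M$. Maximal rank: a positive semidefinite Hermitian matrix $\begin{pmatrix} P & Q\\ Q^\star & S\end{pmatrix}$, with square diagonal blocks $P,S$, is said to be of maximal rank (with respect to this partition) if its nullspace equals $N(P)\oplus N(S)$; equivalently, its rank equals $\operatorname{rank}P+\operatorname{rank}S$. Likewise, the $3\times 3$ block matrix $H(X)$ is of maximal rank if it is positive semidefinite and $N(H(X))=N(A)\oplus N(C)\oplus N(E)$; equivalently, it is positive semidefinite and $\operatorname{rank}H(X)=\operatorname{rank}A+\operatorname{rank}C+\operatorname{rank}E$. *)

(* Defs.v *)
From HB Require Import structures.
From mathcomp Require Import all_boot all_order all_algebra.

Set Implicit Arguments.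
Unset Strict Implicit.
Unset Printing Implicit Defensive.

Import Order.TTheory GRing.Theory Num.Theory.
Local Open Scope ring_scope.
Local Open Scope sesquilinear_scope.

Section MoorePenrose.
Variable C : numClosedFieldType.

Definition penrose m n (A : 'M[C]_(m, n)) (G : 'M[C]_(n, m)) : bool :=
  [&& A *m G *m A == A, G *m A *m G == G,
      (A *m G)^t* == A *m G & (G *m A)^t* == G *m A].

Lemma trmxC_mul m n p (A : 'M[C]_(m, n)) (B : 'M[C]_(n, p)) :
  (A *m B)^t* = B^t* *m A^t*.
Proof. by rewrite trmx_mul map_mxM. Qed.

Lemma mulmx_trmxC_eq0 m n (A : 'M[C]_(m, n)) : A *m A^t* = 0 -> A = 0.
Proof.
move=> A0; apply/matrixP=> i j; rewrite mxE.
have /eqP := congr1 (fun M : 'M_m => M i i) A0; rewrite !mxE psumr_eq0.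
  by move=> /allP/(_ j (mem_index_enum j)); rewrite !mxE mul_conjC_eq0 => /eqP.
by move=> k _; rewrite !mxE mul_conjC_ge0.
Qed.

Lemma gram_unitmx m n (A : 'M[C]_(m, n)) : row_free A -> A *m A^t* \in unitmx.
Proof.
move=> fA; rewrite -row_free_unit -kermx_eq0; apply/eqP.
set K := kermx _; have K0 : K *m (A *m A^t*) = 0 by apply/sub_kermxP.
have: (K *m A) *m (K *m A)^t* = 0 by rewrite trmxC_mul !mulmxA -(mulmxA K) K0 mul0mx.
by move=> /mulmx_trmxC_eq0 /eqP; rewrite mulmx_free_eq0 // => /eqP.
Qed.

Lemma penrose_factor m n k (F : 'M[C]_(m, k)) (R : 'M[C]_(k, n)) :
  row_full F -> row_free R -> exists G, penrose (F *m R) G.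
Proof.
move=> fF fR; pose U := R *m R^t*; pose V := F^t* *m F.
have uU : U \in unitmx by rewrite gram_unitmx.
have uV : V \in unitmx.
  rewrite /V -{2}(trmxCK F) gram_unitmx //.
  by rewrite /row_free mxrank_map mxrank_tr.
have invH (M : 'M[C]_k) : M^t* = M -> (invmx M)^t* = invmx M.
  by move=> MH; rewrite trmx_inv map_invmx MH.
have UH : (invmx U)^t* = invmx U by rewrite invH // /U trmxC_mul trmxCK.
have VH : (invmx V)^t* = invmx V by rewrite invH // /V trmxC_mul trmxCK.
pose G := R^t* *m invmx U *m invmx V *m F^t*.
have AG : F *m R *m G = F *m invmx V *m F^t*.
  by rewrite /G !mulmxA -(mulmxA F R) -/U -(mulmxA F U) mulmxV // mulmx1.
have GA : G *m (F *m R) = R^t* *m invmx U *m R.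
  by rewrite /G !mulmxA -(mulmxA _ _ F) -/V -(mulmxA _ _ V) mulVmx // mulmx1.
exists G; apply/and4P; split; apply/eqP.
- by rewrite AG !mulmxA -(mulmxA _ _ F) -/V -(mulmxA _ _ V) mulVmx // mulmx1.
- by rewrite GA /G !mulmxA -(mulmxA _ R) -/U -(mulmxA _ _ U) mulVmx // mulmx1.
- by rewrite AG !trmxC_mul VH trmxCK mulmxA.
- by rewrite GA !trmxC_mul UH trmxCK mulmxA.
Qed.

Lemma penrose_ex m n (A : 'M[C]_(m, n)) : exists G, penrose A G.
Proof.
have := penrose_factor (col_base_full A) (row_base_free A).
by rewrite mulmx_base.
Qed.

Definition mpinv m n (A : 'M[C]_(m, n)) : 'M[C]_(n, m) := xchoose (penrose_ex A).

Lemma mpinv_penrose m n (A : 'M[C]_(m, n)) : penrose A (mpinv A).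
Proof. exact: xchooseP. Qed.

Lemma penrose_uniq m n (A : 'M[C]_(m, n)) (G G' : 'M[C]_(n, m)) :
  penrose A G -> penrose A G' -> G = G'.
Proof.
move=> /and4P[/eqP a1 /eqP a2 /eqP a3 /eqP a4].
move=> /and4P[/eqP b1 /eqP b2 /eqP b3 /eqP b4].
have eqAG : A *m G = A *m G'.
  by rewrite -a3 -{1}b1 -(mulmxA _ A G) trmxC_mul a3 b3 mulmxA a1.
have eqGA : G *m A = G' *m A.
  by rewrite -a4 -{1}b1 -mulmxA mulmxA trmxC_mul a4 b4 -mulmxA (mulmxA A) a1.
by rewrite -a2 -mulmxA eqAG mulmxA eqGA b2.
Qed.

Lemma penrose_mpinv m n (A : 'M[C]_(m, n)) (G : 'M[C]_(n, m)) :
  penrose A G -> mpinv A = G.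
Proof. by move=> AG; apply: penrose_uniq AG; apply: mpinv_penrose. Qed.

End MoorePenrose.

Section MaximalRank.
Variable C : numClosedFieldType.

(* In a [numClosedFieldType], [0 <= z] entails that [z] is real. *)
Definition psdmx n (M : 'M[C]_n) : Prop :=
  M \is hermsymmx /\ forall v : 'cV[C]_n, 0 <= (v^t* *m M *m v) 0 0.

Definition maximal_rank2 p q (M : 'M[C]_(p + q)) : Prop :=
  psdmx M /\
  forall v : 'cV[C]_(p + q),
    M *m v = 0 <->
    ulsubmx M *m usubmx v = 0 /\ drsubmx M *m dsubmx v = 0.

Definition maximal_rank3 p q r (M : 'M[C]_(p + (q + r))) : Prop :=
  psdmx M /\
  forall v : 'cV[C]_(p + (q + r)),
    M *m v = 0 <->
    [/\ ulsubmx M *m usubmx v = 0,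
        ulsubmx (drsubmx M) *m usubmx (dsubmx v) = 0 &
        drsubmx (drsubmx M) *m dsubmx (dsubmx v) = 0].

Definition hermblock2 p q (A : 'M[C]_p) (B : 'M[C]_(p, q)) (S : 'M[C]_q) :
    'M[C]_(p + q) :=
  block_mx A B (B^t*) S.

(* / A    B    X \
   | B^*  S    D |
   \ X^*  D^*  E / *)
Definition hermblock3 p q r (A : 'M[C]_p) (B : 'M[C]_(p, q)) (S : 'M[C]_q)
    (D : 'M[C]_(q, r)) (E : 'M[C]_r) (X : 'M[C]_(p, r)) :
    'M[C]_(p + (q + r)) :=
  block_mx A (row_mx B X) (col_mx (B^t*) (X^t*)) (block_mx S D (D^t*) E).

Definition block13 p q r (M : 'M[C]_(p + (q + r))) : 'M[C]_(p, r) :=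
  rsubmx (ursubmx M).

End MaximalRank.

(* Main.v *)
Require Import Defs.
From mathcomp Require Import all_boot all_order all_algebra.
From mathcomp Require Import reals complex.
Set Implicit Arguments.
Unset Strict Implicit.
Unset Printing Implicit Defensive.
Import Order.TTheory GRing.Theory Num.Theory.
Local Open Scope ring_scope.

(** Write [P_M] for [M^+ M], the orthogonal projection onto the complement of
    the nullspace of [M] ([rowproj M] below).  Two matrices have the same
    nullspace exactly when these projections agree ([eq_ker_rowproj]), so
    maximal rank of a block matrix says that its projection is block diagonal,
    the diagonal blocks being the projections of the diagonal blocks
    ([maximal_rank2_rowproj], [maximal_rank3_rowproj]).  Applied to the two
    given matrices, this yields the absorption rules [P_A B = B], [B P_C = B]
    and [D P_E = D].

    Existence.  Put [M' := (C D; D^* E)] and [F := (B C^+, 0)].  Since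
    [B C^+ C = B], the last two blocks of the first block row of
    [H(B C^+ D)] are [F M'], so that
      [H(B C^+ D) = T diag(S, M') T^*],  [T := (1 F; 0 1)],
      [S := A - B C^+ B^*].
    The Schur complement [S] is positive semidefinite and, by maximal rank of
    [(A B; B^* C)], has the nullspace of [A].  The projection of
    [diag(S, M')] is therefore [diag(P_A, P_C, P_E)]; it commutes with [T],
    because [P_A F = F = F diag(P_C, P_E)].  For such a [T] the
    Moore-Penrose inverse behaves like an ordinary inverse:
    [H^+ = T^-* diag(S^+, M'^+) T^-1], with [P_H] unchanged
    ([penrose_congr]).  So [H] has maximal rank, and the last two blocks of
    the first block row of [H^+] are [- S^+ F], whose last block is [0]
    because that of [F] is.

    Uniqueness.  Let [G := H(X)^+] have zero upper right block.  Maximal rank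
    gives [H(X) G = diag(P_A, P_C, P_E)], whose last block column reads
      [B G23 + X G33 = 0],  [C G23 + D G33 = 0],  [D^* G23 + E G33 = P_E].
    As [G23 = C^+ C G23], the second equation gives [G23 = - C^+ D G33].
    The first one then becomes [(X - B C^+ D) G33 = 0], and the third one
    [(E - D^* C^+ D) G33 = P_E].  Taking adjoints in the latter shows
    [P_E = G33 (E - D^* C^+ D)], so [(X - B C^+ D) P_E = 0]; both [X] and [D]
    absorb [P_E] on the right, whence [X = B C^+ D]. *)

Section MaximalRankCompletion.
Local Open Scope sesquilinear_scope.
Variable K : numClosedFieldType.

Lemma hermsymmxP n (M : 'M[K]_n) : reflect (M^t* = M) (M \is hermsymmx).
Proof. by rewrite is_hermitianmxE expr0 scale1r eq_sym; apply: eqP. Qed.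

Lemma trmxC_block m1 m2 n1 n2 (A : 'M[K]_(m1, n1)) (B : 'M[K]_(m1, n2))
    (C : 'M[K]_(m2, n1)) (D : 'M[K]_(m2, n2)) :
  (block_mx A B C D)^t* = block_mx (A^t*) (C^t*) (B^t*) (D^t*).
Proof. by rewrite tr_block_mx map_block_mx. Qed.

Lemma trmxC_D m n (A B : 'M[K]_(m, n)) : (A + B)^t* = A^t* + B^t*.
Proof. by rewrite linearD map_mxD. Qed.

Lemma trmxC_N m n (A : 'M[K]_(m, n)) : (- A)^t* = - A^t*.
Proof. by rewrite linearN map_mxN. Qed.

Lemma trmxC_0 m n : (0 : 'M[K]_(m, n))^t* = 0.
Proof. by rewrite trmx0 map_mx0. Qed.

Lemma trmxC_1 n : (1%:M : 'M[K]_n)^t* = 1%:M.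
Proof. by rewrite trmx1 map_mx1. Qed.

Lemma mulmx_cols_eq0 m n k (M : 'M[K]_(m, n)) (V : 'M[K]_(n, k)) :
  (forall j, M *m col j V = 0) -> M *m V = 0.
Proof.
move=> MV; apply/matrixP=> i j.
by have /matrixP/(_ i 0) := MV j; rewrite colE mulmxA -colE !mxE.
Qed.

(** * The orthogonal projection onto the complement of the nullspace *)

Definition rowproj m n (M : 'M[K]_(m, n)) : 'M[K]_n := mpinv M *m M.

Lemma rowproj_trmxC m n (M : 'M[K]_(m, n)) : (rowproj M)^t* = rowproj M.
Proof. by have /and4P[_ _ _ /eqP] := mpinv_penrose M. Qed.

Lemma mulmx_rowproj m n (M : 'M[K]_(m, n)) : M *m rowproj M = M.
Proof. by rewrite mulmxA; have /and4P[/eqP] := mpinv_penrose M. Qed.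

Lemma rowproj_mpinv m n (M : 'M[K]_(m, n)) : rowproj M *m mpinv M = mpinv M.
Proof. by have /and4P[_ /eqP] := mpinv_penrose M. Qed.

Lemma rowproj_eq0 m n k (M : 'M[K]_(m, n)) (V : 'M[K]_(n, k)) :
  rowproj M *m V = 0 <-> M *m V = 0.
Proof.
split=> MV0; last by rewrite -mulmxA MV0 mulmx0.
by rewrite -(mulmx_rowproj M) -mulmxA MV0 mulmx0.
Qed.

(** The columns of [1 - rowproj M] lie in the nullspace of [M]. *)
Lemma mulmx_rowproj_ker m m' n (M : 'M[K]_(m, n)) (N : 'M[K]_(m', n)) :
  (forall v : 'cV_n, M *m v = 0 -> N *m v = 0) -> N *m rowproj M = N.
Proof.
move=> kerMN; apply/esym/eqP; rewrite -subr_eq0 -{1}(mulmx1 N) -mulmxBr.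
apply/eqP/mulmx_cols_eq0 => j; apply: kerMN.
by rewrite colE mulmxA mulmxBr mulmx1 mulmx_rowproj subrr mul0mx.
Qed.

(** Each projection absorbs the other on the right when the nullspaces agree;
    taking adjoints turns one of the two absorptions around. *)
Lemma eq_ker_rowproj m m' n (M : 'M[K]_(m, n)) (N : 'M[K]_(m', n)) :
  (forall v : 'cV_n, M *m v = 0 <-> N *m v = 0) <-> rowproj M = rowproj N.
Proof.
split=> [kerMN | eqMN v]; last by rewrite -rowproj_eq0 eqMN rowproj_eq0.
have NM : rowproj N *m rowproj M = rowproj N.
  by rewrite -mulmxA mulmx_rowproj_ker // => v /kerMN.
have MN : rowproj M *m rowproj N = rowproj M.
  by rewrite -mulmxA mulmx_rowproj_ker // => v /kerMN.
by rewrite -(rowproj_trmxC N) -NM trmxC_mul !rowproj_trmxC MN.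
Qed.

Section Hermitian.
Variables (n : nat) (M : 'M[K]_n).
Hypothesis hM : M^t* = M.

Lemma mpinv_trmxC : (mpinv M)^t* = mpinv M.
Proof.
have /and4P[/eqP MGM /eqP GMG /eqP MG /eqP GM] := mpinv_penrose M.
apply/esym/penrose_mpinv/and4P; split; apply/eqP.
- by rewrite -{1 3}hM -!trmxC_mul mulmxA MGM.
- by rewrite -{2}hM -!trmxC_mul mulmxA GMG.
- by rewrite -{1 3}hM -trmxC_mul GM.
- by rewrite -{2 4}hM -trmxC_mul MG.
Qed.

Lemma mulmx_mpinv_herm : M *m mpinv M = rowproj M.
Proof. by rewrite -(rowproj_trmxC M) trmxC_mul hM mpinv_trmxC. Qed.

Lemma rowproj_mulmx_herm : rowproj M *m M = M.
Proof. by rewrite -{2}hM -rowproj_trmxC -trmxC_mul mulmx_rowproj. Qed.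

Lemma mpinv_rowproj_herm : mpinv M *m rowproj M = mpinv M.
Proof.
by rewrite -{1}mpinv_trmxC -rowproj_trmxC -trmxC_mul rowproj_mpinv mpinv_trmxC.
Qed.

End Hermitian.

Lemma mpinv_block_diag p q (M : 'M[K]_p) (N : 'M[K]_q) :
  mpinv (block_mx M 0 0 N) = block_mx (mpinv M) 0 0 (mpinv N).
Proof.
have /and4P[/eqP M1 /eqP M2 /eqP M3 /eqP M4] := mpinv_penrose M.
have /and4P[/eqP N1 /eqP N2 /eqP N3 /eqP N4] := mpinv_penrose N.
apply: penrose_mpinv; apply/and4P; split; apply/eqP;
  rewrite !mulmx_block !(mul0mx, mulmx0, addr0, add0r) ?trmxC_block ?trmxC_0;
  congr block_mx => //.
Qed.

Lemma rowproj_block_diag p q (M : 'M[K]_p) (N : 'M[K]_q) :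
  rowproj (block_mx M 0 0 N) = block_mx (rowproj M) 0 0 (rowproj N).
Proof.
by rewrite /rowproj mpinv_block_diag mulmx_block
           !(mul0mx, mulmx0, addr0, add0r).
Qed.

(** * Maximal rank in terms of the projection *)

Lemma block_diag_ker p q (M : 'M[K]_p) (N : 'M[K]_q) (v : 'cV[K]_(p + q)) :
  block_mx M 0 0 N *m v = 0 <-> M *m usubmx v = 0 /\ N *m dsubmx v = 0.
Proof.
rewrite -{1}(vsubmxK v) mul_block_col !mul0mx addr0 add0r.
split=> [/eqP|[-> ->]]; last by rewrite col_mx0.
by rewrite col_mx_eq0 => /andP[/eqP-> /eqP->].
Qed.

Lemma maximal_rank2_rowproj p q (A : 'M[K]_p) (B : 'M[K]_(p, q))
    (C : 'M[K]_q) :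
  maximal_rank2 (hermblock2 A B C) ->
  rowproj (hermblock2 A B C) = block_mx (rowproj A) 0 0 (rowproj C).
Proof.
move=> [_ kerM]; rewrite -rowproj_block_diag; apply/eq_ker_rowproj => v.
by rewrite kerM block_diag_ker block_mxKul block_mxKdr.
Qed.

Lemma maximal_rank3_rowproj p q r (A : 'M[K]_p) (B : 'M[K]_(p, q))
    (C : 'M[K]_q) (D : 'M[K]_(q, r)) (E : 'M[K]_r) (X : 'M[K]_(p, r)) :
  let H := hermblock3 A B C D E X in
  maximal_rank3 H <->
  psdmx H /\ rowproj H =
    block_mx (rowproj A) 0 0 (block_mx (rowproj C) 0 0 (rowproj E)).
Proof.
move=> H; rewrite -!rowproj_block_diag -eq_ker_rowproj.
have kerE (v : 'cV_(p + (q + r))) :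
    block_mx A 0 0 (block_mx C 0 0 E) *m v = 0 <->
    [/\ ulsubmx H *m usubmx v = 0,
        ulsubmx (drsubmx H) *m usubmx (dsubmx v) = 0 &
        drsubmx (drsubmx H) *m dsubmx (dsubmx v) = 0].
  rewrite !block_diag_ker /H /hermblock3 !(block_mxKul, block_mxKdr).
  by split=> [[? []]|[]].
split=> -[psdH kerH]; split=> // v; first by rewrite kerH kerE.
by rewrite -kerE.
Qed.

(** Any [M] satisfies [M P_M = M]; when [P_M] is block diagonal, the
    off-diagonal blocks of this identity are [B P_C = B] and
    [B^* P_A = B^*]. *)
Lemma maximal_rank2_absorb p q (A : 'M[K]_p) (B : 'M[K]_(p, q))
    (C : 'M[K]_q) :
  maximal_rank2 (hermblock2 A B C) ->
  rowproj A *m B = B /\ B *m rowproj C = B.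
Proof.
move=> /maximal_rank2_rowproj PM.
have := mulmx_rowproj (hermblock2 A B C); rewrite PM mulmx_block.
rewrite !(mulmx0, addr0, add0r) => /eq_block_mx[_ BC BA _]; split=> //.
by rewrite -[RHS]trmxCK -BA trmxC_mul rowproj_trmxC trmxCK.
Qed.

(** * Congruence *)

Lemma psdmx_congr m n (T : 'M[K]_(m, n)) (M : 'M[K]_n) :
  psdmx M -> psdmx (T *m M *m T^t*).
Proof.
move=> [/hermsymmxP hM posM]; split=> [|v].
  by apply/hermsymmxP; rewrite !trmxC_mul trmxCK hM mulmxA.
by have := posM (T^t* *m v); rewrite trmxC_mul trmxCK !mulmxA.
Qed.

Lemma psdmx_block_diag p q (M : 'M[K]_p) (N : 'M[K]_q) :
  psdmx M -> psdmx N -> psdmx (block_mx M 0 0 N).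
Proof.
move=> [/hermsymmxP hM posM] [/hermsymmxP hN posN]; split=> [|v].
  by apply/hermsymmxP; rewrite trmxC_block !trmxC_0 hM hN.
rewrite -(vsubmxK v) tr_col_mx map_row_mx mul_row_block.
by rewrite !(mulmx0, addr0, add0r) mul_row_col mxE addr_ge0.
Qed.

(** For a general invertible [T] the products of [T M T^*] with
    [T^-* M^+ T^-1] are oblique projections; the commutation makes both of
    them equal to [rowproj M], which is Hermitian. *)
Lemma penrose_congr n (M T Ti : 'M[K]_n) :
  M^t* = M -> T *m Ti = 1%:M -> T *m rowproj M = rowproj M *m T ->
  mpinv (T *m M *m T^t*) = Ti^t* *m mpinv M *m Ti /\
  rowproj (T *m M *m T^t*) = rowproj M.
Proof.
move=> hM TTi TP; set H := _ *m T^t*; set G := _ *m Ti.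
have hH : H^t* = H by rewrite !trmxC_mul trmxCK hM mulmxA.
have hG : G^t* = G by rewrite !trmxC_mul trmxCK mpinv_trmxC // mulmxA.
have TTi' : T^t* *m Ti^t* = 1%:M.
  by rewrite -trmxC_mul (mulmx1C TTi) trmxC_1.
have HG : H *m G = rowproj M.
  rewrite /G !mulmxA -(mulmxA _ (T^t*)) TTi' mulmx1 -(mulmxA T).
  by rewrite mulmx_mpinv_herm // TP -mulmxA TTi mulmx1.
have GH : G *m H = rowproj M.
  by rewrite -[RHS]rowproj_trmxC -HG trmxC_mul hH hG.
have PT : rowproj M *m T^t* = T^t* *m rowproj M.
  by rewrite -rowproj_trmxC -!trmxC_mul TP.
have PTi : rowproj M *m Ti^t* = Ti^t* *m rowproj M.
  by rewrite -[LHS]mul1mx -(mulmx1C TTi') -mulmxA (mulmxA _ (rowproj M)) -PT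
             -mulmxA TTi' mulmx1.
have eqG : mpinv H = G; last by rewrite /rowproj eqG.
apply: penrose_mpinv; apply/and4P; split; apply/eqP.
- by rewrite HG /H !mulmxA -TP -(mulmxA T) rowproj_mulmx_herm.
- by rewrite GH /G !mulmxA PTi -(mulmxA _ (rowproj M)) rowproj_mpinv.
- by rewrite HG rowproj_trmxC.
- by rewrite GH rowproj_trmxC.
Qed.

(** * The Schur complement *)

Section SchurComplement.
Variables (p q : nat) (A : 'M[K]_p) (B : 'M[K]_(p, q)) (C : 'M[K]_q).
Hypothesis hC : C^t* = C.
Hypothesis hABC : maximal_rank2 (hermblock2 A B C).

Let S := A - B *m mpinv C *m B^t*.

Lemma schur_psd : psdmx S.
Proof.
have [_ BC] := maximal_rank2_absorb hABC.
pose T : 'M[K]_(p, p + q) := row_mx 1%:M (- (B *m mpinv C)).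
suff -> : S = T *m hermblock2 A B C *m T^t* by apply: psdmx_congr; case: hABC.
rewrite /T tr_row_mx map_col_mx mul_row_block mul_row_col !mul1mx.
rewrite !mulNmx -!(mulmxA B) BC subrr mul0mx addr0.
by rewrite trmxC_1 mulmx1 /S mulmxA.
Qed.

(** If [S x = 0], then the full matrix kills [(x, - C^+ B^* x)], so maximal
    rank puts [x] in the nullspace of [A].  Conversely [A x = 0] implies
    [B^* x = 0], hence [S x = 0]. *)
Lemma schur_rowproj : rowproj S = rowproj A.
Proof.
have [AB BC] := maximal_rank2_absorb hABC.
apply/eq_ker_rowproj => x; split=> x0.
  have [_ /(_ (col_mx x (- (mpinv C *m B^t* *m x)))) kerM] := hABC.
  have {kerM} := kerM.1; rewrite /hermblock2 mul_block_col !mulmxN !mulmxA.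
  rewrite mulmx_mpinv_herm // -mulmxBl -/S x0.
  have -> : rowproj C *m B^t* = B^t*.
    by rewrite -rowproj_trmxC -trmxC_mul BC.
  by rewrite subrr col_mx0 block_mxKul col_mxKu => /(_ erefl)[].
have Bx : B^t* *m x = 0.
  by rewrite -AB trmxC_mul rowproj_trmxC -mulmxA (rowproj_eq0 _ _).2 // mulmx0.
by rewrite mulmxBl x0 -(mulmxA _ (B^t*)) Bx mulmx0 subrr.
Qed.

End SchurComplement.

(** * The completion *)

Section Completion.
Variables (p q r : nat) (A : 'M[K]_p) (B : 'M[K]_(p, q)) (C : 'M[K]_q).
Variables (D : 'M[K]_(q, r)) (E : 'M[K]_r).
Hypothesis hC : C^t* = C.
Hypothesis hE : E^t* = E.
Hypothesis hABC : maximal_rank2 (hermblock2 A B C).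
Hypothesis hCDE : maximal_rank2 (hermblock2 C D E).

Let X0 := B *m mpinv C *m D.

Lemma completion_exists :
  maximal_rank3 (hermblock3 A B C D E X0) /\
  block13 (mpinv (hermblock3 A B C D E X0)) = 0.
Proof.
have [AB BC] := maximal_rank2_absorb hABC.
have [psdM _] := hCDE.
have /hermsymmxP hM := psdM.1.
set S := A - B *m mpinv C *m B^t*.
have psdS : psdmx S by apply: schur_psd.
have PS : rowproj S = rowproj A by apply: schur_rowproj.
have /hermsymmxP hS := psdS.1.
set M := hermblock2 C D E in psdM hM *.
have PM : rowproj M = block_mx (rowproj C) 0 0 (rowproj E).
  exact: maximal_rank2_rowproj.
pose F : 'M[K]_(p, q + r) := row_mx (B *m mpinv C) 0.
pose T := block_mx 1%:M F 0 1%:M.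
pose Ti := block_mx 1%:M (- F) 0 1%:M.
pose Delta := block_mx S 0 0 M.
have FM : F *m M = row_mx B X0.
  by rewrite /F mul_row_block !mul0mx !addr0 -(mulmxA B) BC.
have FMF : F *m M *m F^t* = B *m mpinv C *m B^t*.
  rewrite FM /F tr_row_mx map_col_mx mul_row_col trmxC_0 mulmx0 addr0.
  by rewrite trmxC_mul mpinv_trmxC // mulmxA.
have HE : hermblock3 A B C D E X0 = T *m Delta *m T^t*.
  rewrite /T trmxC_block !trmxC_1 trmxC_0 !mulmx_block.
  rewrite !(mul0mx, mulmx0, mul1mx, mulmx1, addr0, add0r).
  rewrite FMF /S subrK FM -[M in M *m _]hM -trmxC_mul FM.
  by rewrite tr_row_mx map_col_mx.
have PD : rowproj Delta = block_mx (rowproj A) 0 0 (rowproj M).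
  by rewrite rowproj_block_diag PS.
have TTi : T *m Ti = 1%:M.
  rewrite mulmx_block !(mul0mx, mulmx0, mul1mx, mulmx1, addr0, add0r).
  by rewrite addNr -scalar_mx_block.
have TP : T *m rowproj Delta = rowproj Delta *m T.
  rewrite PD !mulmx_block !(mul0mx, mulmx0, mul1mx, mulmx1, addr0, add0r).
  congr block_mx; rewrite PM /F mul_row_block mul_mx_row (mulmxA _ B) AB.
  by rewrite !mulmx0 mul0mx !addr0 -(mulmxA B) mpinv_rowproj_herm.
have hD : Delta^t* = Delta by rewrite trmxC_block !trmxC_0 hS hM.
have [GE PH] := penrose_congr hD TTi TP.
split.
  apply/maximal_rank3_rowproj; rewrite HE; split; last by rewrite PH PD PM.
  exact/psdmx_congr/psdmx_block_diag.
rewrite HE GE mpinv_block_diag /Ti trmxC_block !trmxC_1 trmxC_0 !mulmx_block.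
rewrite !(mul0mx, mulmx0, mul1mx, mulmx1, addr0, add0r) /block13 block_mxKur.
by rewrite /F opp_row_mx oppr0 mul_mx_row mulmx0 row_mxKr.
Qed.

Lemma completion_unique (X : 'M[K]_(p, r)) :
  maximal_rank3 (hermblock3 A B C D E X) ->
  block13 (mpinv (hermblock3 A B C D E X)) = 0 -> X = X0.
Proof.
set H := hermblock3 A B C D E X => /maximal_rank3_rowproj[[/hermsymmxP hH _]].
rewrite -/H => PH; set G := mpinv H => G13.
have [_ DE] := maximal_rank2_absorb hCDE.
have GE : G = block_mx (ulsubmx G) (ursubmx G) (dlsubmx G)
   (block_mx (ulsubmx (drsubmx G)) (ursubmx (drsubmx G))
             (dlsubmx (drsubmx G)) (drsubmx (drsubmx G))) by rewrite !submxK.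
have UE : ursubmx G = row_mx (lsubmx (ursubmx G)) 0.
  by rewrite -[0]G13 hsubmxK.
move: GE; rewrite UE.
set G23 := ursubmx (drsubmx G); set G33 := drsubmx (drsubmx G) => GE.
have hG33 : G33^t* = G33.
  have := mpinv_trmxC hH; rewrite -/G {1 2}GE trmxC_block.
  by case/eq_block_mx=> _ _ _; rewrite trmxC_block => /eq_block_mx[].
(* only the last block column of H G = P_H is kept *)
have := mulmx_mpinv_herm hH; rewrite PH -/G GE /H /hermblock3 mulmx_block.
rewrite mul_row_block mul_mx_row mulmx0 add_row_mx add0r mul_col_row.
rewrite !mulmx0 mulmx_block add_block_mx !add0r.
case/eq_block_mx=> _ /eqP; rewrite row_mx_eq0 => /andP[_ /eqP row1] _.
case/eq_block_mx=> _ row2 _ row3.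
(* read off the (2,3) block of P_H G = G *)
have CG : rowproj C *m G23 = G23.
  have := rowproj_mpinv H; rewrite -/G PH GE mulmx_block.
  case/eq_block_mx=> _ _ _; rewrite !mul0mx add0r mulmx_block.
  by case/eq_block_mx=> _; rewrite !mul0mx addr0.
have XE : X *m rowproj E = X.
  have := mulmx_rowproj H; rewrite PH /H /hermblock3 mulmx_block.
  case/eq_block_mx=> _; rewrite !mulmx0 add0r mul_row_block.
  by rewrite !mulmx0 add0r => /eq_row_mx[].
have G23E : G23 = - (mpinv C *m D *m G33).
  rewrite -CG /rowproj -!mulmxA -mulmxN; congr (_ *m _).
  by apply/eqP; rewrite -addr_eq0 row2.
have XG : (X - X0) *m G33 = 0.
  rewrite mulmxBl; apply/eqP.
  by rewrite -row1 G23E mulmxN addrC !mulmxA.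
have EG : (E - D^t* *m mpinv C *m D) *m G33 = rowproj E.
  by rewrite mulmxBl -row3 G23E mulmxN addrC !mulmxA.
have GEH : G33 *m (E - D^t* *m mpinv C *m D) = rowproj E.
  rewrite -[RHS]rowproj_trmxC -EG trmxC_mul hG33 trmxC_D trmxC_N !trmxC_mul.
  by rewrite trmxCK hE mpinv_trmxC // !mulmxA.
apply/eqP; rewrite -subr_eq0 -XE /X0 -DE mulmxA -mulmxBl -/X0 -GEH mulmxA XG.
by rewrite mul0mx.
Qed.

End Completion.
End MaximalRankCompletion.

Theorem theorem5p4 (R : realType) (p q r : nat)
    (hp : (1 <= p)%N) (hq : (1 <= q)%N) (hr : (1 <= r)%N)
    (A : 'M[complex R]_p) (B : 'M[complex R]_(p, q)) (C : 'M[complex R]_q)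
    (D : 'M[complex R]_(q, r)) (E : 'M[complex R]_r)
    (hA : A \is hermsymmx) (hC : C \is hermsymmx) (hE : E \is hermsymmx)
    (hABC : maximal_rank2 (hermblock2 A B C))
    (hCDE : maximal_rank2 (hermblock2 C D E)) :
  unique
    (fun X : 'M[complex R]_(p, r) =>
       maximal_rank3 (hermblock3 A B C D E X) /\
       block13 (mpinv (hermblock3 A B C D E X)) = 0)
    (B *m mpinv C *m D).
Proof.
move/hermsymmxP: hC => hC; move/hermsymmxP: hE => hE.
split; first exact: completion_exists.
by move=> X [rkX /(completion_unique hC hE hCDE rkX)->].
Qed.
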